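(* For all formulas $\phi,\chi$: if there is a tableaux proof of $\phi\vdash_{\mathrm{NFL}_{\mathbf{M3}}}\chi$ (in the calculus described in the context), then $\phi\vDash_{\mathrm{NFL}_{\mathbf{M3}}}\chi$.
   Context: Semantics: $\mathbf{M3}$ is the lattice on $\{\mathbf{T},\mathbf{B},\mathbf{0},\mathbf{N},\mathbf{F}\}$ with top $\mathbf{T}$, bottom $\mathbf{F}$ and three pairwise incomparable middle elements $\mathbf{B},\mathbf{0},\mathbf{N}$. Formulas are built from propositional variables using $\neg,\wedge,\vee$; a valuation maps variables to $\mathbf{M3}$ and is extended by interpreting $\wedge,\vee$ as meet and join of $\mathbf{M3}$ and $\neg$ by $\neg\mathbf{T}=\mathbf{F}$, $\neg\mathbf{F}=\mathbf{T}$, $\neg x=x$ for $x\in\{\mathbf{B},\mathbf{0},\mathbf{N}\}$. $\phi\vDash_{\mathrm{NFL}_{\mathbf{M3}}}\chi$ iff for every valuation $v$, $v(\phi)\neq\mathbf{F}$ implies $v(\chi)\neq\mathbf{F}$. Tableaux: a tableau is a downward branching tree whose nodes contain labelled formulas $\mathfrak{t}[\phi]$, $\mathfrak{m}[\phi]$, $\mathfrak{f}[\phi]$ and labelled pairs $\phi\sim\chi$, $\phi\nsim\chi$; branches are regarded as sets. A branch containing the premise(s) of a rule may be extended by the rule; conclusions separated by $\mid$ split the branch. Rules ($i\in\{1,2\}$, $p,q,r$ propositional variables, $\circ\in\{\wedge,\vee\}$): $(\mathfrak{t}\wedge)$: $\mathfrak{t}[\phi\wedge\chi]$ / $\mathfrak{t}[\phi],\mathfrak{t}[\chi]$.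 $(\mathfrak{t}\vee)$: $\mathfrak{t}[\phi\vee\chi]$ / $\mathfrak{t}[\phi]\mid\mathfrak{t}[\chi]\mid\mathfrak{m}[\phi],\mathfrak{m}[\chi],\phi\nsim\chi$. $(\mathfrak{t}\neg)$: $\mathfrak{t}[\neg\phi]$ / $\mathfrak{f}[\phi]$. $(\mathfrak{m}\wedge)$: $\mathfrak{m}[\phi\wedge\chi]$ / $\mathfrak{t}[\phi],\mathfrak{m}[\chi]\mid\mathfrak{m}[\phi],\mathfrak{t}[\chi]\mid\mathfrak{m}[\phi],\mathfrak{m}[\chi],\phi\sim\chi$. $(\mathfrak{m}\vee)$: $\mathfrak{m}[\phi\vee\chi]$ / $\mathfrak{f}[\phi],\mathfrak{m}[\chi]\mid\mathfrak{m}[\phi],\mathfrak{f}[\chi]\mid\mathfrak{m}[\phi],\mathfrak{m}[\chi],\phi\sim\chi$. $(\mathfrak{m}\neg)$: $\mathfrak{m}[\neg\phi]$ / $\mathfrak{m}[\phi],\phi\sim\neg\phi$. $(\mathfrak{f}\wedge)$: $\mathfrak{f}[\phi\wedge\chi]$ / $\mathfrak{f}[\phi]\mid\mathfrak{f}[\chi]\mid\mathfrak{m}[\phi],\mathfrak{m}[\chi],\phi\nsim\chi$. $(\mathfrak{f}\vee)$: $\mathfrak{f}[\phi\vee\chi]$ / $\mathfrak{f}[\phi],\mathfrak{f}[\chi]$. $(\mathfrak{f}\neg)$: $\mathfrak{f}[\neg\phi]$ / $\mathfrak{t}[\phi]$. $(\sim\mathsf{sym})$: $\phi\sim\chi$ /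 $\chi\sim\phi$; $(\nsim\mathsf{sym})$: $\phi\nsim\chi$ / $\chi\nsim\phi$. $(\sim\mathsf{trans})$: $p\sim q,q\sim r$ / $p\sim r$; $(\nsim\mathsf{trans})$: $p\nsim q,q\sim r$ / $p\nsim r$. $(\neg\sim)$: $\neg\phi\sim\chi$ / $\phi\sim\chi$; $(\neg\nsim)$: $\neg\phi\nsim\chi$ / $\phi\nsim\chi$. $(\circ\sim)$: $\phi\sim\chi_1\circ\chi_2,\mathfrak{m}[\chi_i]$ / $\phi\sim\chi_i$; $(\circ\nsim)$: $\phi\nsim\chi_1\circ\chi_2,\mathfrak{m}[\chi_i]$ / $\phi\nsim\chi_i$. A branch is closed iff it contains one of: (1) $\mathcal{M}[\phi]$ and $\mathcal{M}'[\phi]$ for distinct labels $\mathcal{M},\mathcal{M}'\in\{\mathfrak{t},\mathfrak{m},\mathfrak{f}\}$; (2) $\phi\sim\chi$ and $\phi\nsim\chi$; (3) $\phi\nsim\phi$; (4) formulas $\phi_1,\ldots,\phi_4$ with $\phi_i\nsim\phi_j$ for all $1\le i<j\le 4$. A tableau is closed iff all its branches are closed. There is a tableaux proof of $\phi\vdash_{\mathrm{NFL}_{\mathbf{M3}}}\chi$ iff there are closed tableaux beginning with $\{\mathfrak{m}[\phi],\mathfrak{f}[\chi]\}$ and with $\{\mathfrak{t}[\phi],\mathfrak{f}[\chi]\}$. *)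

(* Defs.v *)
From HB Require Import structures.
From Stdlib Require Import List.
From mathcomp Require Import all_boot all_order.

Set Implicit Arguments.
Unset Strict Implicit.
Unset Printing Implicit Defensive.

Import Order.Theory.
Local Open Scope order_scope.

Inductive M3 : Type := vT | vB | v0 | vN | vF.

Definition M3_code (x : M3) : nat :=
  match x with vT => 0 | vB => 1 | v0 => 2 | vN => 3 | vF => 4 end.
Definition M3_decode (n : nat) : option M3 := onth [:: vT; vB; v0; vN; vF] n.
Lemma M3_codeK : pcancel M3_code M3_decode. Proof. by case. Qed.
HB.instance Definition _ := Countable.copy M3 (pcan_type M3_codeK).

Fact M3_display : Order.disp_t. Proof. exact: Order.Disp tt tt. Qed.

Definition M3_le (x y : M3) : bool := [|| x == vF, x == y | y == vT].

Lemma M3_le_refl : reflexive M3_le. Proof. by case. Qed.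
Lemma M3_le_anti : antisymmetric M3_le. Proof. by do 2!case. Qed.
Lemma M3_le_trans : transitive M3_le. Proof. by do 3!case. Qed.
HB.instance Definition _ :=
  Order.Le_isPOrder.Build M3_display M3 M3_le_refl M3_le_anti M3_le_trans.

Definition M3_meet (x y : M3) : M3 :=
  if M3_le x y then x else if M3_le y x then y else vF.
Definition M3_join (x y : M3) : M3 :=
  if M3_le x y then y else if M3_le y x then x else vT.

Lemma M3_meetP (x y z : M3) : (x <= M3_meet y z) = (x <= y) && (x <= z).
Proof. by case: x y z; do 2!case. Qed.
Lemma M3_joinP (x y z : M3) : (M3_join x y <= z) = (x <= z) && (y <= z).
Proof. by case: x y z; do 2!case. Qed.
HB.instance Definition _ :=
  Order.POrder_MeetJoin_isLattice.Build M3_display M3 M3_meetP M3_joinP.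

Lemma M3_vF_le (x : M3) : vF <= x. Proof. by []. Qed.
Lemma M3_le_vT (x : M3) : x <= vT. Proof. by case: x. Qed.
HB.instance Definition _ := Order.hasBottom.Build M3_display M3 M3_vF_le.
HB.instance Definition _ := Order.hasTop.Build M3_display M3 M3_le_vT.

Definition M3_neg (x : M3) : M3 :=
  match x with vT => vF | vF => vT | vB => vB | v0 => v0 | vN => vN end.

Inductive formula (V : Type) : Type :=
| Var of V
| Neg of formula V
| And of formula V & formula V
| Or of formula V & formula V.

Fixpoint eval (V : Type) (v : V -> M3) (phi : formula V) : M3 :=
  match phi with
  | Var p => v p
  | Neg f => M3_neg (eval v f)
  | And f g => eval v f `&` eval v g
  | Or f g => eval v f `|` eval v g
  end.

Definition entails (V : Type) (phi chi : formula V) : Prop :=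
  forall v : V -> M3, eval v phi <> vF -> eval v chi <> vF.

Inductive label : Type := lab_t | lab_m | lab_f.

Inductive item (V : Type) : Type :=
| Lab of label & formula V
| Sim of formula V & formula V
| NSim of formula V & formula V.

Local Notation "'t[' phi ]" := (Lab lab_t phi) (at level 0, phi at level 200).
Local Notation "'m[' phi ]" := (Lab lab_m phi) (at level 0, phi at level 200).
Local Notation "'f[' phi ]" := (Lab lab_f phi) (at level 0, phi at level 200).
Local Notation "phi ~~~ chi" := (Sim phi chi) (at level 70, no associativity).
Local Notation "phi ~/~ chi" := (NSim phi chi) (at level 70, no associativity).

(* [rule ps css]: from the premises [ps], the branch splits into [size css]
   branches, the i-th of which receives the items in the i-th list of [css]. *)
Inductive rule (V : Type) : seq (item V) -> seq (seq (item V)) -> Prop :=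
| r_t_and f g : rule [:: t[And f g]] [:: [:: t[f]; t[g]]]
| r_t_or f g : rule [:: t[Or f g]]
    [:: [:: t[f]]; [:: t[g]]; [:: m[f]; m[g]; f ~/~ g]]
| r_t_neg f : rule [:: t[Neg f]] [:: [:: f[f]]]
| r_m_and f g : rule [:: m[And f g]]
    [:: [:: t[f]; m[g]]; [:: m[f]; t[g]]; [:: m[f]; m[g]; f ~~~ g]]
| r_m_or f g : rule [:: m[Or f g]]
    [:: [:: f[f]; m[g]]; [:: m[f]; f[g]]; [:: m[f]; m[g]; f ~~~ g]]
| r_m_neg f : rule [:: m[Neg f]] [:: [:: m[f]; f ~~~ Neg f]]
| r_f_and f g : rule [:: f[And f g]]
    [:: [:: f[f]]; [:: f[g]]; [:: m[f]; m[g]; f ~/~ g]]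
| r_f_or f g : rule [:: f[Or f g]] [:: [:: f[f]; f[g]]]
| r_f_neg f : rule [:: f[Neg f]] [:: [:: t[f]]]
| r_sim_sym f g : rule [:: f ~~~ g] [:: [:: g ~~~ f]]
| r_nsim_sym f g : rule [:: f ~/~ g] [:: [:: g ~/~ f]]
| r_sim_trans p q r : rule [:: Var p ~~~ Var q; Var q ~~~ Var r]
    [:: [:: Var p ~~~ Var r]]
| r_nsim_trans p q r : rule [:: Var p ~/~ Var q; Var q ~~~ Var r]
    [:: [:: Var p ~/~ Var r]]
| r_neg_sim f g : rule [:: Neg f ~~~ g] [:: [:: f ~~~ g]]
| r_neg_nsim f g : rule [:: Neg f ~/~ g] [:: [:: f ~/~ g]]
| r_op_sim op f g1 g2 g : op = @And V \/ op = @Or V -> g = g1 \/ g = g2 ->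
    rule [:: f ~~~ op g1 g2; m[g]] [:: [:: f ~~~ g]]
| r_op_nsim op f g1 g2 g : op = @And V \/ op = @Or V -> g = g1 \/ g = g2 ->
    rule [:: f ~/~ op g1 g2; m[g]] [:: [:: f ~/~ g]].

(* The type is coinductive so that infinite tableaux are not excluded; finite
   ones are a special case. *)
CoInductive tree (V : Type) : Type := Node of seq (item V) & seq (tree V).

Definition items (V : Type) (t : tree V) : seq (item V) :=
  let: Node s _ := t in s.
Definition children (V : Type) (t : tree V) : seq (tree V) :=
  let: Node _ ts := t in ts.

(* [built B t]: the subtree [t], hanging below nodes whose items form the set
   [B], is obtained by extending branches by rules. *)
CoInductive built (V : Type) (B : item V -> Prop) (t : tree V) : Prop :=
| built_leaf : children t = [::] -> built B t
| built_rule ps css :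
    rule ps css ->
    (forall x, In x ps -> B x \/ In x (items t)) ->
    [seq items t' | t' <- children t] = css ->
    (forall t', In t' (children t) ->
       built (fun x => B x \/ In x (items t)) t') ->
    built B t.

Definition tableau (V : Type) (s : seq (item V)) (t : tree V) : Prop :=
  items t = s /\ built (fun _ => False) t.

(* [b n] is the node at depth [n], or [None] beyond a leaf. *)
Definition maximal_path (V : Type) (t : tree V) (b : nat -> option (tree V)) :
    Prop :=
  b 0 = Some t /\
  forall n, match b n with
            | None => b n.+1 = None
            | Some u =>
                if nilp (children u) then b n.+1 = None
                else exists2 u', In u' (children u) & b n.+1 = Some u'
            end.

Definition path_items (V : Type) (b : nat -> option (tree V)) (x : item V) :
    Prop :=
  exists n u, b n = Some u /\ In x (items u).

Definition closed_branch (V : Type) (B : item V -> Prop) : Prop :=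
  [\/ exists l l' phi, [/\ l <> l', B (Lab l phi) & B (Lab l' phi)],
      exists phi chi, B (phi ~~~ chi) /\ B (phi ~/~ chi),
      exists phi, B (phi ~/~ phi)
    | exists phi : 'I_4 -> formula V,
        forall i j : 'I_4, (i < j)%N -> B (phi i ~/~ phi j)].

Definition closed_tableau (V : Type) (t : tree V) : Prop :=
  forall b, maximal_path t b -> closed_branch (path_items b).

Definition provable (V : Type) (phi chi : formula V) : Prop :=
  (exists t, tableau [:: m[phi]; f[chi]] t /\ closed_tableau t) /\
  (exists t, tableau [:: t[phi]; f[chi]] t /\ closed_tableau t).

(* Main.v *)
From Stdlib Require Import List.
From mathcomp Require Import all_boot.
Require Import Defs.

(** Suppose [v] refutes the entailment. One of the two starting sets of items
    then holds under [v], where [phi ~ chi] (resp. its negation) means that both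
    values are middle elements and are equal (resp. distinct). Every rule
    whose premises hold has an alternative all of whose conclusions hold, so
    from the root one can always descend to a child with true items. The
    resulting branch contains true items only and is not closed: in case (4)
    there would be four distinct middle elements. *)

Set Implicit Arguments.
Unset Strict Implicit.
Unset Printing Implicit Defensive.

Definition middle (x : M3) : bool := (x != vT) && (x != vF).

(* The rules for negated formulas under [Sim] and [NSim] are sound only because
   both sides are required to be middle elements. *)
Definition holds (V : Type) (v : V -> M3) (x : item V) : bool :=
  match x with
  | Lab lab_t f => eval v f == vT
  | Lab lab_m f => middle (eval v f)
  | Lab lab_f f => eval v f == vF
  | Sim f g => middle (eval v f) && (eval v f == eval v g)
  | NSim f g =>
      [&& middle (eval v f), middle (eval v g) & eval v f != eval v g]
  end.

(** Each rule depends on the values of at most three formulas, so a finite check over [M3]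
    suffices. *)
Lemma rule_sound (V : Type) (v : V -> M3) (ps : seq (item V))
    (css : seq (seq (item V))) :
  rule ps css -> forallb (holds v) ps -> List.existsb (forallb (holds v)) css.
Proof.
case=> [f g|f g|f|f g|f g|f|f g|f g|f|f g|f g|p q r|p q r|f g|f g
  |op f g1 g2 g [->|->] [->|->]|op f g1 g2 g [->|->] [->|->]] /=;
do ?[by case: (eval v f) | by case: (eval v f); case: (eval v g)
    |by case: (v p); case: (v q); case: (v r)
    |by case: (eval v f); case: (eval v g1); case: (eval v g2)].
Qed.

(** [M3] has only three middle elements: [vB], [v0] and [vN]. *)
Lemma middle_pigeonhole (x : 'I_4 -> M3) :
  ~ (forall i j : 'I_4, i < j ->
       [&& middle (x i), middle (x j) & x i != x j]).
Proof.
move=> x_neq.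
have := x_neq (@Ordinal 4 0 isT) (@Ordinal 4 1 isT) isT.
have := x_neq (@Ordinal 4 0 isT) (@Ordinal 4 2 isT) isT.
have := x_neq (@Ordinal 4 0 isT) (@Ordinal 4 3 isT) isT.
have := x_neq (@Ordinal 4 1 isT) (@Ordinal 4 2 isT) isT.
have := x_neq (@Ordinal 4 1 isT) (@Ordinal 4 3 isT) isT.
have := x_neq (@Ordinal 4 2 isT) (@Ordinal 4 3 isT) isT.
by case: (x (@Ordinal 4 0 isT)); case: (x (@Ordinal 4 1 isT));
  case: (x (@Ordinal 4 2 isT)); case: (x (@Ordinal 4 3 isT)).
Qed.

Lemma closed_branch_false (V : Type) (v : V -> M3) (B : item V -> Prop) :
  (forall x, B x -> holds v x) -> ~ closed_branch B.
Proof.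
move=> B_holds [[l [l' [f [neq_l /B_holds + /B_holds]]]]
  |[f [g [/B_holds + /B_holds]]]|[f /B_holds]|[f f_neq]] /=.
- by case: l l' neq_l => -[] //=; case: (eval v f).
- by move=> /andP[_ ->] /and3P[].
- by rewrite eqxx !andbF.
- apply: (@middle_pigeonhole (fun i => eval v (f i))) => i j /f_neq.
  exact: B_holds.
Qed.

(** Truth of items is decidable, so searching the finite list of children makes the descent a
    function, without any choice principle. *)
Definition true_child (V : Type) (v : V -> M3) (t : tree V) :
    option (tree V) :=
  List.find (fun t' => forallb (holds v) (items t')) (children t).

Fixpoint true_path (V : Type) (v : V -> M3) (t : tree V) (n : nat) :
    option (tree V) :=
  if n is n'.+1 then obind (true_child v) (true_path v t n') else Some t.

(** [B] stands for the items above [t], among which premises may lie; it is existential since it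
    grows along the path. *)
Definition true_node (V : Type) (v : V -> M3) (t : tree V) : Prop :=
  forallb (holds v) (items t) /\
  exists2 B, (forall x, B x -> holds v x) & built B t.

Lemma true_childP (V : Type) (v : V -> M3) (t : tree V) :
  true_node v t ->
  match true_child v t with
  | Some t' => In t' (children t) /\ true_node v t'
  | None => children t = [::]
  end.
Proof.
move=> [/forallb_forall t_holds [B B_holds]].
have Bt_holds x : B x \/ In x (items t) -> holds v x.
  by case; [exact: B_holds | exact: t_holds].
case=> [nil_t|ps css ps_css ps_in css_eq built_t]; rewrite /true_child.
  by rewrite nil_t.
case child_eq: List.find => [t'|].
  have [t'_in t'_holds] := find_some _ _ child_eq; split=> //.
  by split=> //; exists (fun x => B x \/ In x (items t)) => //; exact: built_t.
(* The search failed, yet soundness of the rule provides a child with true items. *)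
have : List.existsb (forallb (holds v)) css.
  apply: (rule_sound ps_css); apply/forallb_forall => x /ps_in.
  exact: Bt_holds.
rewrite -css_eq => /existsb_exists[c [/in_map_iff[t' [<- t'_in]]]].
by rewrite (find_none _ _ child_eq t' t'_in).
Qed.

Lemma true_path_true (V : Type) (v : V -> M3) (t : tree V) n u :
  true_node v t -> true_path v t n = Some u -> true_node v u.
Proof.
move=> t_true; elim: n u => [|n IHn] u /= => [[<-] //|].
case: true_path IHn => [w|] //= /(_ w erefl) /true_childP.
by case: true_child => // u' [_ u'_true] [<-].
Qed.

Lemma true_path_maximal (V : Type) (v : V -> M3) (t : tree V) :
  true_node v t -> maximal_path t (true_path v t).
Proof.
move=> t_true; split=> // n /=.
case path_n: true_path => [u|] //=.
have := true_childP (true_path_true t_true path_n).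
case child_u: true_child => [u'|]; last by move=> ->.
by case=> u'_in _; case: (children u) u'_in => //= w ws u'_in; exists u'.
Qed.

Lemma closed_tableau_unsat (V : Type) (v : V -> M3) (s : seq (item V))
    (t : tree V) :
  tableau s t -> closed_tableau t -> ~~ forallb (holds v) s.
Proof.
move=> [<- built_t] closed_t; apply/negP => t_holds.
have t_true : true_node v t by split=> //; exists (fun=> False).
apply: (closed_branch_false _ (closed_t _ (true_path_maximal t_true))).
move=> x [n [u [path_n x_in]]].
have [/forallb_forall u_holds _] := true_path_true t_true path_n.
exact: u_holds.
Qed.

Theorem theorem3 (V : Type) (phi chi : formula V) :
  provable phi chi -> entails phi chi.
Proof.
move=> [[tm [tm_tab tm_closed]] [tt [tt_tab tt_closed]]] v phi_v chi_v.
have := closed_tableau_unsat v tm_tab tm_closed.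
have := closed_tableau_unsat v tt_tab tt_closed.
(* The value of [phi] is [vT], which makes the root of [tt] true, or middle, which makes that of
   [tm] true. *)
by rewrite /= chi_v; case: (eval v phi) phi_v.
Qed.
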